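(* Let $k\ge 4$ be an integer, $\bar\kappa=\lceil k/2\rceil$, let $\mathcal{L}_A^{(\bar\kappa)}$ be the Laplacian matrix of the connected antiregular graph on $\bar\kappa$ vertices, and let $\mathcal{L}^{(k)}_{\tilde A}$ be the Laplacian matrix of the graph $\mathbb{G}^{(k)}_{\tilde A}$ obtained by joining two antiregular graphs by one edge (both defined in the context). Let $\bar{\boldsymbol b}\in\{0,1\}^{\bar\kappa}$ be a binary vector and let $\boldsymbol b\in\{0,1\}^k$ be its zero-padding $\boldsymbol b^T=\left[\,\bar{\boldsymbol b}^T\ \mathbf 0^T\,\right]$. Then the following statements are equivalent: 1. $\left(\mathcal{L}^{(\bar\kappa)}_A,\bar{\boldsymbol b}\right)$ is controllable; 2. the sum of the $\left\lceil\frac{\bar\kappa}{2}\right\rceil$th and $\left(\left\lceil\frac{\bar\kappa}{2}\right\rceil+1\right)$th entries of $\bar{\boldsymbol b}$ is $1$; 3. $\left(\mathcal{L}^{(k)}_{\tilde A},\boldsymbol b\right)$ is controllable.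
   Context: $(\mathcal{L},\boldsymbol b)$ denotes the single-input linear time-invariant control system $\dot{\boldsymbol x}=-\mathcal{L}\boldsymbol x+\boldsymbol b u(t)$; controllability is meant in the usual sense (equivalently, no eigenvector of the symmetric matrix $\mathcal{L}$ is orthogonal to $\boldsymbol b$). For $m\ge2$, the connected antiregular graph $\mathbb{G}_A^{(m)}$ is the (unique up to isomorphism) connected simple graph on $m$ vertices with exactly two vertices of equal degree. Its vertices are numbered $1,\dots,m$ in nonincreasing order of degree, so that distinct vertices $i,j$ are adjacent if and only if $i+j\le m+1$; the two vertices of equal degree (namely $\lfloor m/2\rfloor$) are $\lceil m/2\rceil$ and $\lceil m/2\rceil+1$, and vertex $1$ is dominating (adjacent to all others). $\mathcal{L}_A^{(m)}$ is its Laplacian matrix (diagonal degree matrix minus adjacency matrix) in this ordering. For an integer $k$ put $\bar\kappa=\lceil k/2\rceil$ and $\underline{\kappa}=\lfloor k/2\rfloor$. The graph $\mathbb{G}^{(k)}_{\tilde A}$ is obtained from the disjoint union of $\mathbb{G}_A^{(\bar\kappa)}$ (vertices $1,\dots,\bar\kappa$) and $\mathbb{G}_A^{(\underline\kappa)}$ (vertices $\bar\kappa+1,\dots,k$) by adding one edge between the dominating vertex $1$ of $\mathbb{G}_A^{(\bar\kappa)}$ and the vertex $\bar\kappa+\lceil\underline\kappa/2\rceil$, one of the two equal-degree vertices of $\mathbb{G}_A^{(\underline\kappa)}$. Its Laplacian matrix is $$\mathcal{L}^{(k)}_{\tilde A}=\begin{bmatrix}\mathcal{L}_A^{(\bar\kappa)}&0\\0&\mathcal{L}_A^{(\underline\kappa)}\end{bmatrix}+\boldsymbol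 z\boldsymbol z^T,\qquad \boldsymbol z=\boldsymbol e_1-\boldsymbol e_{\bar\kappa+\lceil\underline\kappa/2\rceil},$$ where $\boldsymbol e_i$ is the $i$th standard basis vector of $\mathbb{R}^k$. *)

(* Defs.v *)
From HB Require Import structures.
From mathcomp Require Import all_boot all_order all_algebra zify.
From mathcomp Require Import all_classical all_reals all_analysis.

Set Implicit Arguments.
Unset Strict Implicit.
Unset Printing Implicit Defensive.

Import Order.TTheory GRing.Theory Num.Theory.
Import numFieldNormedType.Exports.

Local Open Scope classical_set_scope.
Local Open Scope ring_scope.

(* Vertices and coordinates written 1, ..., n on paper are the ordinals
   0, ..., n - 1; formulas below use i.+1 for the number of the vertex i. *)

Definition degree (n : nat) (e : rel 'I_n) (i : 'I_n) : nat :=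
  #|[set j | e i j]%SET|.

Definition laplacian (R : pzRingType) (n : nat) (e : rel 'I_n) : 'M[R]_n :=
  \matrix_(i, j) ((degree e i)%:R *+ (i == j) - (e i j)%:R).

Definition antireg (m : nat) : rel 'I_m :=
  fun i j => (i != j) && (i.+1 + j.+1 <= m.+1)%N.

(* uphalf n is the ceiling of n / 2 and n./2 its floor. The vertex set
   'I_(uphalf k + k./2) has k elements (uphalf_half_add below); the sum is kept
   so that split separates the vertices of the two antiregular graphs. *)
Definition joined_antireg (k : nat) : rel 'I_(uphalf k + k./2) :=
  fun i j =>
    let bridge (a : 'I_(uphalf k)) (c : 'I_(k./2)) :=
      (a.+1 == 1)%N && (c.+1 == uphalf k./2)%N in
    match fintype.split i, fintype.split j with
    | inl a, inl a' => antireg a a'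
    | inr c, inr c' => antireg c c'
    | inl a, inr c => bridge a c
    | inr c, inl a => bridge a c
    end.

(* x is a solution on [0, T] of x' = - L x + b u. *)
Definition is_trajectory (R : realType) (n : nat) (L : 'M[R]_n) (b : 'cV[R]_n)
    (T : R) (u : R -> R) (x : R -> 'cV[R]_n) : Prop :=
  (forall i, {within `[0, T], continuous (fun t => x t i 0)}) /\
  (forall t, t \in `]0, T[ -> forall i,
     is_derive t 1 (fun s => x s i 0) ((- L *m x t + u t *: b) i 0)).

(* Every state can be steered to every state in finite time by a continuous
   input; for a linear system the class of inputs (continuous, piecewise
   continuous, integrable) does not affect this property. *)
Definition controllable (R : realType) (n : nat) (L : 'M[R]_n) (b : 'cV[R]_n) :
    Prop :=
  forall x0 x1 : 'cV[R]_n,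
    exists (T : R) (u : R -> R) (x : R -> 'cV[R]_n),
      [/\ 0 < T, {within `[0, T], continuous u}, is_trajectory L b T u x,
          x 0 = x0 & x T = x1].

Definition binary (R : realType) (n : nat) (b : 'cV[R]_n) : Prop :=
  forall i, b i 0 = 0 \/ b i 0 = 1.

(* The p-th entry of v, for p counted from 1 and 1 <= p <= n. *)
Definition entry (R : realType) (n : nat) (v : 'cV[R]_n) (p : nat) : R :=
  if insub p.-1 is Some i then v i 0 else 0.

(* The p-th standard basis vector, for p counted from 1. *)
Definition basis_vec (R : realType) (n p : nat) : 'cV[R]_n :=
  \col_i (i.+1 == p)%:R.

Lemma entryE (R : realType) (n : nat) (v : 'cV[R]_n) (i : 'I_n) :
  entry v i.+1 = v i 0.
Proof. by rewrite /entry /= valK. Qed.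

Lemma uphalf_half_add (k : nat) : (uphalf k + k./2)%N = k.
Proof. by lia. Qed.

(* antireg m is a connected simple graph whose degrees are nonincreasing and
   pairwise distinct, except for the vertices numbered uphalf m and
   (uphalf m).+1. *)
Lemma antireg_sym (m : nat) : symmetric (@antireg m).
Proof. by move=> i j; rewrite /antireg eq_sym addnC. Qed.

Lemma antireg_irr (m : nat) : irreflexive (@antireg m).
Proof. by move=> i; rewrite /antireg eqxx. Qed.

Lemma antireg_connect (m : nat) (i j : 'I_m) :
  fingraph.connect (@antireg m) i j.
Proof.
have m_gt0 : (0 < m)%N by apply: leq_ltn_trans (ltn_ord i).
pose o := Ordinal m_gt0.
have oc l : fingraph.connect (@antireg m) o l.
  have [->|ol] := eqVneq l o; first exact: fingraph.connect0.
  by apply: fingraph.connect1; rewrite /antireg eq_sym ol /= add1n ltnS ltn_ord.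
apply: fingraph.connect_trans (oc j).
by rewrite (fingraph.sym_connect_sym (@antireg_sym m)) oc.
Qed.

Lemma degree_antireg (m : nat) (i : 'I_m) :
  degree (@antireg m) i = (m - i - (i + i < m))%N.
Proof.
pose A := [set j : 'I_m | (j < m - i)%N]%SET.
have cA : #|A| = (m - i)%N.
  rewrite cardsE -sum1_card -(big_ord_widen _ (fun=> 1%N)) ?leq_subr //.
  by rewrite sum1_card card_ord.
have -> : degree (@antireg m) i = #|(A :\ i)%SET|.
  congr #|pred_of_set _|; apply/setP => j; rewrite !inE /antireg eq_sym.
  by congr (_ && _); lia.
by have := cardsD1 i A; rewrite cA inE; lia.
Qed.

Lemma degree_antireg_noninc (m : nat) (i j : 'I_m) :
  (i <= j)%N -> (degree (@antireg m) j <= degree (@antireg m) i)%N.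
Proof. by rewrite !degree_antireg; move: (ltn_ord i) (ltn_ord j); lia. Qed.

Lemma degree_antireg_eq (m : nat) (i j : 'I_m) : (i < j)%N ->
  (degree (@antireg m) i == degree (@antireg m) j) =
  (i.+1 == uphalf m) && (j.+1 == (uphalf m).+1).
Proof. by rewrite !degree_antireg; move: (ltn_ord i) (ltn_ord j); lia. Qed.

Lemma degree_joined_antireg (k : nat) (hk : (4 <= k)%N)
    (i : 'I_(uphalf k + k./2)) :
  degree (@joined_antireg k) i =
    match fintype.split i with
    | inl a => degree (@antireg (uphalf k)) a + (a.+1 == 1)
    | inr c => degree (@antireg k./2) c + (c.+1 == uphalf k./2)
    end%N.
Proof.
have sum1 n (p : 'I_n) (q : nat) : q = p.+1 -> (\sum_(c < n) (c.+1 == q) = 1)%N.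
  move=> ->; rewrite (bigD1 p) //= eqxx big1 // => c cp.
  by rewrite eqSS -[_ == _]/(c == p) (negbTE cp).
have dS n (e : rel 'I_n) l : degree e l = (\sum_j e l j)%N.
  rewrite /degree cardsE -sum1_card big_mkcond; apply: eq_bigr => j _.
  by rewrite [X in if X then _ else _]unfold_in; case: (e l j).
have lt0 : (0 < uphalf k)%N by lia.
have lt1 : ((uphalf k./2).-1 < k./2)%N by lia.
rewrite -[i]splitK; case: (fintype.split i) => a;
  rewrite unsplitK !dS big_split_ord /=; last rewrite addnC;
  congr (_ + _)%N.
- by apply: eq_bigr => c _; rewrite /joined_antireg !(unsplitK (inl _)).
- rewrite (eq_bigr (fun c : 'I__ => (a.+1 == 1) * (c.+1 == uphalf k./2))%N).
    by rewrite -big_distrr /= (sum1 _ (Ordinal lt1)) ?muln1 //=; lia.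
  move=> c _.
  by rewrite /joined_antireg (unsplitK (inl a)) (unsplitK (inr c)) mulnb.
- by apply: eq_bigr => c _; rewrite /joined_antireg !(unsplitK (inr _)).
rewrite (eq_bigr (fun c : 'I__ => (c.+1 == 1) * (a.+1 == uphalf k./2))%N).
  by rewrite -big_distrl /= (sum1 _ (Ordinal lt0)) ?mul1n.
move=> c _.
by rewrite /joined_antireg (unsplitK (inr a)) (unsplitK (inl c)) mulnb.
Qed.

Lemma laplacian_joined_antireg (R : realType) (k : nat) (hk : (4 <= k)%N) :
  let z : 'cV[R]_(uphalf k + k./2) :=
    basis_vec R _ 1 - basis_vec R _ (uphalf k + uphalf k./2)%N in
  laplacian R (@joined_antireg k) =
  block_mx (laplacian R (@antireg (uphalf k))) 0
           0 (laplacian R (@antireg k./2)) + z *m z^T.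
Proof.
move=> z; apply/matrixP => i j.
have zl (a : 'I_(uphalf k)) : z (lshift _ a) 0 = (a.+1 == 1)%:R.
  have aF : (a.+1 == uphalf k + uphalf k./2)%N = false.
    by move: (ltn_ord a); lia.
  by rewrite !mxE /= aF subr0.
have zr (c : 'I_k./2) : z (rshift _ c) 0 = - (c.+1 == uphalf k./2)%:R.
  have cF : ((uphalf k + c).+1 == 1)%N = false by lia.
  by rewrite !mxE /= cF -addnS eqn_add2l sub0r.
have bb (p q : bool) : p%:R * q%:R = (p && q)%:R :> R by rewrite -natrM mulnb.
have zz : (z *m z^T) i j = z i 0 * z j 0 by rewrite mxE big_ord1 [z^T _ _]mxE.
rewrite [RHS]mxE zz [LHS]mxE degree_joined_antireg // {zz}.
rewrite -[i]splitK -[j]splitK /joined_antireg.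
case: (fintype.split i) => a; case: (fintype.split j) => c; rewrite !unsplitK /=
  ?zl ?zr ?block_mxEul ?block_mxEur ?block_mxEdl ?block_mxEdr.
- rewrite mxE eq_lshift natrD mulrnDl addrAC; congr (_ + _).
  have [<-|ac] := eqVneq a c; first by rewrite bb andbb.
  rewrite mulr0n bb; suff -> : (a.+1 == 1) && (c.+1 == 1) = false by [].
  by apply/negbTE; move: ac; rewrite -val_eqE /=; lia.
- by rewrite mxE eq_lrshift mulr0n mulrN bb.
- by rewrite mxE eq_rlshift mulr0n mulNr bb andbC.
rewrite mxE eq_rshift natrD mulrnDl addrAC; congr (_ + _).
have [<-|ac] := eqVneq a c; first by rewrite mulrNN bb andbb.
rewrite mulr0n mulrNN bb.
suff -> : (a.+1 == uphalf k./2) && (c.+1 == uphalf k./2) = false by [].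
by apply/negbTE; move: ac; rewrite -val_eqE /=; lia.
Qed.

(* Main.v *)
Require Import Defs.
From mathcomp Require Import all_boot all_order all_algebra.
From mathcomp Require Import all_classical all_reals all_analysis.
From mathcomp Require Import zify ring lra.
From mathcomp Require Import complex.

Set Implicit Arguments.
Unset Strict Implicit.
Unset Printing Implicit Defensive.

Import Order.TTheory GRing.Theory Num.Theory.
Import numFieldNormedType.Exports.

Local Open Scope classical_set_scope.
Local Open Scope ring_scope.

(** Both controllability properties are decided by the eigenvectors of a symmetric
    matrix L: the system x' = - L x + b u is controllable exactly when no
    eigenvector of L is orthogonal to b ([controllableP]). If an eigenvector is
    orthogonal to b, its inner product with the state ignores the input.
    Conversely, the adjugate of X + L provides a flat output: a polynomial y and
    its derivatives parametrize the state, so that steering becomes Hermite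
    interpolation of y at two times, provided the vectors [flat_vec] are
    independent; if they are not, their annihilator is an L-invariant space
    orthogonal to b, and it contains a real eigenvector since L is symmetric.

    For the antiregular graph, number the vertices in the order t = 0, 1, ... in
    which the graph is built by adding in turn an isolated vertex and a dominating
    one, so that the two vertices of equal degree come first and the final vertex
    is dominating ([build_order]). Then the Laplacian has the eigenvectors
    1 and w_c = c e_c - (e_0 + ... + e_(c-1)) for 0 < c < n, with distinct integer
    eigenvalues covering 0, ..., n except the ceiling of n / 2. If a binary b has
    exactly one of its two entries on the twin vertices equal to 1, then between
    1 and c - 1 of its first c entries are 1 when c >= 2, so that b is orthogonal
    to no w_c, nor to 1. If the two entries agree, the twin eigenvector w_1 is
    orthogonal to b, and it extends to an eigenvector of the joined graph.

    For the joined graph, let (x, y) be an eigenvector with eigenvalue lam whose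
    first half is orthogonal to b, and let d be the difference of its values at
    the ends of the bridge. If d = 0, then x and y are eigenvectors of the two
    antiregular graphs; x vanishes by the above, so y vanishes at a twin vertex
    and is zero too, by the same result applied to the indicator of that vertex.
    If d <> 0, scale so that d = 1. Let m be the order of the first graph and n,
    which is m or m - 1, that of the second. Pairing the equation for x with the
    w_c and using that x is orthogonal to b shows that lam is a positive integer
    smaller than m; pairing the equation for y with the w_c shows that lam is not
    an eigenvalue of the second graph. This leaves for lam only the ceiling of
    n / 2; but then x is nonpositive at its end of the bridge and y is larger than
    -1 at the other, so d < 1 ([bridge_absurd]). *)

(** * Eigenvectors orthogonal to the input *)

Lemma row_sqr_ge0 (R : realDomainType) (n : nat) (x : 'rV[R]_n) :
  0 <= (x *m x^T) 0 0.
Proof. by rewrite mxE sumr_ge0 // => i _; rewrite mxE -expr2 sqr_ge0. Qed.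

Lemma row_sqr_eq0 (R : realDomainType) (n : nat) (x : 'rV[R]_n) :
  (x *m x^T) 0 0 = 0 -> x = 0.
Proof.
rewrite mxE; under eq_bigr do rewrite mxE -expr2.
move/eqP; rewrite psumr_eq0 => [/allP x0|i _]; last exact: sqr_ge0.
apply/rowP => i; rewrite mxE; apply/eqP.
by rewrite -sqrf_eq0; apply: x0; rewrite mem_index_enum.
Qed.

Lemma within_continuous_sum (R : realType) (n : nat) (A : set R)
    (F : 'I_n -> R -> R) :
  (forall i, {within A, continuous (F i)}) ->
  {within A, continuous (fun t => \sum_i F i t)}.
Proof.
move=> cF t; rewrite -fct_sumE.
by elim/big_ind : _ => [|f g cf cg|i _]; [exact: cst_continuous| |exact: cF];
  exact: continuousD.
Qed.

(** Along a trajectory from 0, the product of exp (a t) and v x(t) has derivative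
    zero, hence stays 0; taking v^T as the target gives v v^T = 0. *)
Lemma controllable_eigenvector_eq0 (R : realType) (n : nat) (L : 'M[R]_n)
    (b : 'cV[R]_n) (v : 'rV[R]_n) (a : R) :
  controllable L b -> v *m L = a *: v -> v *m b = 0 -> v = 0.
Proof.
move=> Lb vL vb.
have [T [u [x [T0 cu [cx dx] x0 x1]]]] := Lb 0 v^T.
pose w t := \sum_i v 0 i * x t i 0.
pose g t := expR (a * t) * w t.
have dg t : t \in `]0, T[ -> is_derive t 1 g 0.
  move=> tT.
  pose dw := \sum_i v 0 i * (- L *m x t + u t *: b) i 0.
  have dwE : dw = - a * w t.
    transitivity ((v *m (- L *m x t + u t *: b)) 0 0); first by rewrite mxE.
    rewrite mulmxDr mulmxA -scalemxAr vb scaler0 addr0 mulmxN vL mulNmx.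
    by rewrite -scalemxAl mulNr 3!mxE.
  have dW : is_derive t 1 w dw.
    rewrite /w -fct_sumE; apply: is_derive_sum => i.
    by have := dx t tT i => H; exact: is_deriveZ.
  have dE : is_derive t 1 (fun s => expR (a * s)) (expR (a * t) * a).
    apply: (@is_derive1_comp _ expR (fun s => a * s)).
    by rewrite -[X in is_derive _ _ _ X]mulr1; exact: is_deriveZ.
  apply: is_derive_eq (is_deriveM dE dW) _.
  by rewrite dwE /GRing.scale /=; ring.
have cg : {within `[0, T], continuous g}.
  move=> t; apply: (@continuousM R (subspace `[0, T]) (fun s => expR (a * s)) w t).
    apply: continuous_subspaceT => s.
    apply: continuous_comp; last exact: continuous_expR.
    exact: mulrl_continuous.
  apply: within_continuous_sum => i s.
  apply: (@continuousM R (subspace `[0, T]) (cst (v 0 i)) (fun s => x s i 0)).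
    exact: cst_continuous.
  exact: cx.
have [c _] := MVT T0 dg cg.
have -> : g 0 = 0.
  by rewrite /g /w x0 big1 ?mulr0 // => i _; rewrite mxE mulr0.
rewrite mul0r subr0 /g /w x1 => /eqP; rewrite mulf_eq0 gt_eqF ?expR_gt0 //=.
by move=> /eqP vv; apply: row_sqr_eq0; rewrite mxE.
Qed.

(** * Hermite interpolation at 0 and 1 *)

Lemma horner_derivn_root (R : comNzRingType) (a : R) (n : nat) (q : {poly R}) :
  (forall j, (j < n)%N -> ((('X - a%:P) ^+ n * q)^`(j)).[a] = 0) /\
  ((('X - a%:P) ^+ n * q)^`(n)).[a] = n`!%:R * q.[a].
Proof.
elim: n q => [|n IH] q; first by split=> //; rewrite expr0 mul1r derivn0 mul1r.
have dE : (('X - a%:P) ^+ n.+1 * q)^`() =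
    ('X - a%:P) ^+ n * (q *+ n.+1 + ('X - a%:P) * q^`()).
  rewrite derivM deriv_exp derivXsubC mul1r exprS /= mulrDr mulrnAl mulrnAr.
  by congr (_ + _); rewrite mulrA; congr (_ * _); exact: mulrC.
have [IH0 IHn] := IH (q *+ n.+1 + ('X - a%:P) * q^`()).
split=> [[|j] jn|].
- by rewrite derivn0 exprS -mulrA hornerM hornerXsubC subrr mul0r.
- by rewrite derivSn dE; exact: IH0.
rewrite derivSn dE IHn hornerD hornerM hornerXsubC subrr mul0r addr0.
by rewrite hornerMn factS natrM mulrnAr -mulr_natl mulrA.
Qed.

Lemma hermite_interpolation (R : numFieldType) (n : nat) (c d : nat -> R) :
  exists y : {poly R}, forall j, (j < n)%N ->
    (y^`(j)).[0] = c j /\ (y^`(j)).[1] = d j.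
Proof.
elim: n => [|n [y IH]]; first by exists 0.
pose u0 : R := n`!%:R * (-1) ^+ n.
pose u1 : R := n`!%:R.
have u1_neq0 : u1 != 0 by rewrite pnatr_eq0 -lt0n fact_gt0.
have u0_neq0 : u0 != 0 by rewrite mulf_neq0 // signr_eq0.
pose al := (c n - (y^`(n)).[0]) / u0; pose be := (d n - (y^`(n)).[1]) / u1.
(* The added multiple of 'X^n ('X - 1)^n leaves the jets of order < n alone,
   and its n-th derivatives at 0 and 1 are scaled values of a linear factor. *)
pose l := al%:P + (be - al) *: 'X.
exists (y + 'X ^+ n * ('X - 1%:P) ^+ n * l) => j; rewrite ltnS => jn.
rewrite derivnD !hornerD.
have [A0 An] := @horner_derivn_root R 0 n (('X - 1%:P) ^+ n * l).
have [B0 Bn] := @horner_derivn_root R 1 n ('X ^+ n * l).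
rewrite subr0 mulrA in A0 An; rewrite mulrCA mulrA in B0 Bn.
have [->|j_neq] := eqVneq j n; last first.
  have jn' : (j < n)%N by rewrite ltn_neqAle j_neq.
  by rewrite A0 ?B0 ?addr0 //; exact: IH.
have l0 : l.[0] = al by rewrite hornerD hornerC hornerZ hornerX mulr0 addr0.
have l1 : l.[1] = be by rewrite hornerD hornerC hornerZ hornerX mulr1 subrKC.
rewrite An Bn !hornerM horner_exp hornerXsubC sub0r hornerXn expr1n mul1r l0 l1.
by rewrite mulrA -/u0 -/u1 !(mulrC _ (_ / _)) !divfK // !subrKC.
Qed.

(** * Real eigenvectors in invariant subspaces *)

(** Apply the factors A - z to v one at a time: the last nonzero vector obtained
    is an eigenvector, and it has stayed in U. *)
Lemma eigenvector_of_invariant (F : fieldType) (n : nat) (A : 'M[F]_n.+1)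
    (U : 'rV[F]_n.+1 -> Prop) (s : seq F) (v : 'rV[F]_n.+1) :
  (forall w a, U w -> U (w *m A - a *: w)) ->
  v *m horner_mx A (\prod_(z <- s) ('X - z%:P)) = 0 -> U v -> v != 0 ->
  exists u z, [/\ U u, u != 0 & u *m A = z *: u].
Proof.
move=> UA; elim: s v => [|z s IH] v.
  by rewrite big_nil rmorph1 mulmx1 => -> _; rewrite eqxx.
rewrite big_cons rmorphM /= rmorphB /= horner_mx_X horner_mx_C mulmxA.
rewrite mulmxBr mul_mx_scalar => vs Uv v0.
have [/eqP|w0] := eqVneq (v *m A - z *: v) 0; last exact: IH vs (UA _ _ Uv) w0.
by rewrite subr_eq0 => /eqP vA; exists v, z.
Qed.

Section Complexification.
Variable R : realType.
Local Notation toC := (complex.real_complex R).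

Let re (z : complex.complex R) : R := let: complex.Complex p _ := z in p.
Let im (z : complex.complex R) : R := let: complex.Complex _ q := z in q.

(** Over the complex numbers the characteristic polynomial splits, which gives a
    complex eigenvector annihilating K. By symmetry of A its eigenvalue is real, so
    the real and the imaginary parts are eigenvectors or zero. *)
Lemma real_eigenvector_of_invariant (n : nat) (A : 'M[R]_n.+1) (m : nat)
    (K : 'M[R]_(n.+1, m)) (v : 'rV[R]_n.+1) :
  A^T = A ->
  (forall w : 'rV[R]_n.+1, w *m K = 0 -> w *m A *m K = 0) ->
  v *m K = 0 -> v != 0 ->
  exists (u : 'rV[R]_n.+1) (a : R), [/\ u *m K = 0, u != 0 & u *m A = a *: u].
Proof.
move=> Asym KA vK v0.
have reD x y : re (x + y) = re x + re y by case: x; case: y.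
have imD x y : im (x + y) = im x + im y by case: x; case: y.
have reM x y : re (x * toC y) = re x * y.
  by case: x => p q /=; rewrite mulr0 subr0.
have imM x y : im (x * toC y) = im x * y.
  by case: x => p q /=; rewrite mulr0 add0r.
pose reV (u : 'rV[complex.complex R]_n.+1) : 'rV[R]_n.+1 := \row_i re (u 0 i).
pose imV (u : 'rV[complex.complex R]_n.+1) : 'rV[R]_n.+1 := \row_i im (u 0 i).
have reE p (u : 'rV_n.+1) (B : 'M[R]_(n.+1, p)) i : re ((u *m map_mx toC B) 0 i) =
    (reV u *m B) 0 i.
  rewrite !mxE (big_morph re reD erefl).
  by apply: eq_bigr => j _; rewrite !mxE reM.
have imE p (u : 'rV_n.+1) (B : 'M[R]_(n.+1, p)) i : im ((u *m map_mx toC B) 0 i) =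
    (imV u *m B) 0 i.
  rewrite !mxE (big_morph im imD erefl).
  by apply: eq_bigr => j _; rewrite !mxE imM.
have complex_eq (z w : complex.complex R) : re z = re w -> im z = im w -> z = w.
  by case: z; case: w => ? ? ? ? /= -> ->.
have KE (u : 'rV[complex.complex R]_n.+1) :
    u *m map_mx toC K = 0 <-> reV u *m K = 0 /\ imV u *m K = 0.
  split=> [u0|[u1 u2]].
    by split; apply/rowP => i; rewrite -?reE -?imE u0 !mxE.
  by apply/rowP => i; apply: complex_eq; rewrite ?reE ?imE ?u1 ?u2 !mxE.
pose AC := map_mx toC A.
have [s charE] := closed_field_poly_normal (char_poly AC).
move: charE; rewrite (monicP (char_poly_monic _)) scale1r => charE.
have [||||u [z [Ku u0 uA]]] := @eigenvector_of_invariant (complex.complex R) n AC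
  (fun w : 'rV_n.+1 => w *m map_mx toC K = 0) s (map_mx toC v).
- move=> w a wK; rewrite mulmxBl -scalemxAl wK scaler0 subr0.
  have [w1 w2] := (KE w).1 wK.
  apply/KE.
  have -> : reV (w *m AC) = reV w *m A by apply/rowP => i; rewrite mxE reE.
  have -> : imV (w *m AC) = imV w *m A by apply/rowP => i; rewrite mxE imE.
  by split; apply: KA.
- by rewrite -charE Cayley_Hamilton mulmx0.
- by rewrite -map_mxM vK map_mx0.
- by rewrite map_mx_eq0.
have [K1 K2] := (KE u).1 Ku.
case: z uA => al be uA.
have A1 : reV u *m A = al *: reV u - be *: imV u.
  apply/rowP => i; rewrite -reE uA !mxE.
  by case: (u 0 i).
have A2 : imV u *m A = al *: imV u + be *: reV u.
  apply/rowP => i; rewrite -imE uA !mxE.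
  by case: (u 0 i).
have be0 : be = 0.
  have /matrixP/(_ 0 0) : reV u *m A *m (imV u)^T = (imV u *m A *m (reV u)^T)^T.
    by rewrite !trmx_mul trmxK Asym mulmxA.
  rewrite A1 A2 mulmxBl mulmxDl linearD /= -!scalemxAl !linearZ /= trmx_mul trmxK.
  rewrite trmx_mul trmxK.
  have := @row_sqr_eq0 _ _ (reV u); have := @row_sqr_eq0 _ _ (imV u).
  have := row_sqr_ge0 (reV u); have := row_sqr_ge0 (imV u).
  move: (reV u *m (imV u)^T) (imV u *m _) (reV u *m _) => P Q S Q0 S0 Qeq Seq.
  rewrite !(mxE, mulr1) => H.
  have /eqP : be * (Q 0 0 + S 0 0) = 0 by lra.
  rewrite mulf_eq0 paddr_eq0 // => /orP[/eqP //|/andP[/eqP /Qeq Q1 /eqP /Seq S1]].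
  case/eqP: u0; apply/rowP => i; apply: complex_eq; rewrite [in RHS]mxE /=.
    by move/rowP/(_ i): S1; rewrite !mxE.
  by move/rowP/(_ i): Q1; rewrite !mxE.
rewrite be0 !scale0r ?subr0 ?addr0 in A1 A2.
have [c0|c0] := eqVneq (imV u) 0; last by exists (imV u), al.
exists (reV u), al; split=> //; apply: contra_neq u0 => a0.
apply/rowP => i; apply: complex_eq; rewrite [in RHS]mxE /=.
  by move/rowP/(_ i): a0; rewrite !mxE.
by move/rowP/(_ i): c0; rewrite !mxE.
Qed.
End Complexification.

(** * Flat parametrization of the trajectories *)

Section Flat.
Variables (R : realType) (n : nat) (A : 'M[R]_n.+1) (b : 'cV[R]_n.+1).

Let chi := char_poly A.

(** The coefficient of X^j in adj (X - A) b: the polynomial [drop_poly j.+1 chi]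
    evaluated at A is the coefficient of X^j in (chi(X) - chi(A)) / (X - A). *)
Definition flat_vec (j : nat) : 'cV[R]_n.+1 :=
  horner_mx A (drop_poly j.+1 chi) *m b.

Lemma flat_vec_rec j :
  A *m flat_vec j + chi`_j *: b = horner_mx A (drop_poly j chi) *m b.
Proof.
have -> : drop_poly j chi = 'X * drop_poly j.+1 chi + (chi`_j)%:P.
  apply/polyP => i; rewrite coefD coefXM coefC !coef_drop_poly.
  case: i => [|i] /=; first by rewrite add0n add0r.
  by rewrite addr0 addnS addSn.
rewrite rmorphD rmorphM /= horner_mx_X horner_mx_C mulmxDl mul_scalar_mx.
by rewrite mulmxA.
Qed.

Lemma flat_vec_step j : A *m flat_vec j.+1 + chi`_j.+1 *: b = flat_vec j.
Proof. exact: flat_vec_rec. Qed.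

Lemma flat_vec_start : A *m flat_vec 0 + chi`_0 *: b = 0.
Proof. by rewrite flat_vec_rec drop_poly0l Cayley_Hamilton mul0mx. Qed.

Lemma flat_vec_last : flat_vec n = b.
Proof.
rewrite /flat_vec; have -> : drop_poly n.+1 chi = 1.
  have sz : size (drop_poly n.+1 chi) = 1%N.
    by rewrite size_drop_poly size_char_poly subSnn.
  rewrite [drop_poly _ _]size1_polyC ?sz // coef_drop_poly add0n.
  have := monicP (char_poly_monic A); rewrite lead_coefE size_char_poly /= => ->.
  by [].
by rewrite rmorph1 mul1mx.
Qed.

Lemma flat_vec_oversize : flat_vec n.+1 = 0.
Proof.
by rewrite /flat_vec drop_poly_eq0 ?size_char_poly // rmorph0 mul0mx.
Qed.

Definition flat_state (y : {poly R}) (t : R) : 'cV[R]_n.+1 :=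
  \sum_(j < n.+1) (y^`(j)).[t] *: flat_vec j.

Definition flat_input (y : {poly R}) (t : R) : R :=
  \sum_(j < n.+2) chi`_j * (y^`(j)).[t].

(** The identity (X - A) adj (X - A) b = chi(X) b, with X acting on y as
    differentiation. *)
Lemma flat_trajectory y t :
  flat_state y^`() t = A *m flat_state y t + flat_input y t *: b.
Proof.
transitivity (\sum_(j < n.+2) (y^`(j)).[t] *: (A *m flat_vec j + chi`_j *: b)).
  rewrite big_ord_recl flat_vec_start scaler0 add0r.
  by apply: eq_bigr => i _; rewrite flat_vec_step derivSn.
under eq_bigr do rewrite scalerDr scalerA (mulrC _ chi`_ _).
rewrite big_split /= -scaler_suml big_ord_recr /= flat_vec_oversize mulmx0.
rewrite scaler0 addr0 mulmx_sumr; congr (_ + _).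
by apply: eq_bigr => j _; rewrite scalemxAr.
Qed.

Lemma is_derive_flat_state (y : {poly R}) (t : R) i :
  is_derive t 1 (fun s => flat_state y s i 0) (flat_state y^`() t i 0).
Proof.
have H (p : {poly R}) : is_derive t 1 (horner p) (p^`()).[t].
  rewrite derivE derive1E; apply/derivableP; exact: derivable_horner.
have -> : (fun s => flat_state y s i 0) =
    \sum_(j < n.+1) (flat_vec j i 0 \*: horner (y^`(j))).
  apply/funext => s; rewrite fct_sumE summxE.
  by apply: eq_bigr => j _; rewrite mxE mulrC.
have -> : flat_state y^`() t i 0 =
    \sum_(j < n.+1) (flat_vec j i 0 *: (y^`(j)^`()).[t]).
  rewrite summxE.
  by apply: eq_bigr => j _; rewrite mxE mulrC -derivSn derivnS.
by apply: is_derive_sum => j; apply: is_deriveZ.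
Qed.

End Flat.

(** When the vectors [flat_vec] form a basis, prescribing the state at a time
    amounts to prescribing the derivatives of y there of order at most n. *)
Lemma controllable_of_free (R : realType) (n : nat) (L : 'M[R]_n.+1)
    (b : 'cV[R]_n.+1) :
  row_free (\matrix_(i < n.+1, j < n.+1) flat_vec (- L) b j i 0) ->
  controllable L b.
Proof.
set K := (\matrix_(i, j) _) => Kfree x0 x1.
have KE c : \sum_(j < n.+1) c j *: flat_vec (- L) b j = K *m \col_j c j.
  apply/colP => i; rewrite summxE mxE; apply: eq_bigr => j _.
  by rewrite !mxE mulrC.
have Kunit : K \in unitmx by rewrite -row_free_unit.
pose coord (x : 'cV[R]_n.+1) (j : nat) : R := (invmx K *m x) (inord j) 0.
have [y yE] := hermite_interpolation n.+1 (coord x0) (coord x1).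
have stateE (t : R) x : (forall j, (j < n.+1)%N -> (y^`(j)).[t] = coord x j) ->
    flat_state (- L) b y t = x.
  move=> yt; rewrite /flat_state (KE (fun j : 'I_n.+1 => (y^`(j)).[t])).
  rewrite -[RHS](mulKVmx Kunit); congr (_ *m _); apply/colP => i.
  by rewrite mxE yt // /coord inord_val.
exists 1, (flat_input (- L) y), (flat_state (- L) b y); split=> //.
- apply: continuous_subspaceT.
  have -> : flat_input (- L) y =
      horner (\sum_(j < n.+2) (char_poly (- L))`_j *: y^`(j)).
    apply/funext => t; rewrite horner_sum /flat_input.
    by apply: eq_bigr => j _; rewrite hornerZ.
  exact: continuous_horner.
- split=> [i|t _ i].
    apply: continuous_subspaceT => t; apply: differentiable_continuous.
    by apply/derivable1_diffP; case: (is_derive_flat_state (- L) b y t i).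
  by rewrite -flat_trajectory; exact: is_derive_flat_state.
- by apply: stateE => j jn; exact: (yE j jn).1.
- by apply: stateE => j jn; exact: (yE j jn).2.
Qed.

(** The row vectors annihilating all [flat_vec] are orthogonal to b, which is one
    of them, and the recurrence [flat_vec_step] then makes them an invariant
    space. *)
Lemma controllable_of_eigenvectors (R : realType) (n : nat) (L : 'M[R]_n)
    (b : 'cV[R]_n) :
  L^T = L ->
  (forall (v : 'rV[R]_n) a, v *m L = a *: v -> v *m b = 0 -> v = 0) ->
  controllable L b.
Proof.
case: n L b => [|n] L b Lsym eigen0.
  move=> x0 x1; exists 1, (cst 0), (cst 0); split=> //.
  - exact: cst_continuous.
  - by split=> [[]|t _ []].
  - by apply/colP => -[].
  - by apply/colP => -[].
apply: controllable_of_free; set K := (\matrix_(i, j) _).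
apply: contraT; rewrite -kermx_eq0 => /rowV0Pn[v /sub_kermxP vK v0].
have KE (w : 'rV[R]_n.+1) : w *m K = 0 <->
    (forall j, (j < n.+1)%N -> w *m flat_vec (- L) b j = 0).
  have wE j (jn : (j < n.+1)%N) : (w *m K) 0 (Ordinal jn) =
      (w *m flat_vec (- L) b j) 0 0.
    by rewrite !mxE; apply: eq_bigr => i _; rewrite !mxE.
  split=> [w0 j jn|w0]; last first.
    by apply/rowP => -[j jn]; rewrite wE w0 // !mxE.
  by apply/rowP => i; rewrite ord1 -(wE _ jn) w0 !mxE.
have KL (w : 'rV[R]_n.+1) : w *m K = 0 -> w *m (- L) *m K = 0.
  move=> /KE w0; apply/KE => j jn.
  have wb : w *m b = 0 by rewrite -(flat_vec_last (- L) b) w0.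
  rewrite -mulmxA; case: j jn => [|j] jn.
    have := congr1 (mulmx w) (flat_vec_start (- L) b).
    by rewrite mulmxDr -scalemxAr wb scaler0 addr0 mulmx0.
  have := congr1 (mulmx w) (flat_vec_step (- L) b j).
  by rewrite mulmxDr -scalemxAr wb scaler0 addr0 => ->; rewrite w0 // ltnW.
have [|u [a [uK u0 uL]]] := real_eigenvector_of_invariant _ KL vK v0.
  by rewrite linearN /= Lsym.
case/eqP: u0; apply: (eigen0 u (- a)).
  by rewrite scaleNr -uL mulmxN opprK.
by rewrite -(flat_vec_last (- L) b); apply: (KE u).1.
Qed.

(** The Popov-Belevitch-Hautus test for symmetric L. *)
Lemma controllableP (R : realType) n (L : 'M[R]_n) (b : 'cV[R]_n) : L^T = L ->
  controllable L b <->
  (forall (v : 'cV[R]_n) a, L *m v = a *: v -> (v^T *m b) 0 0 = 0 -> v = 0).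
Proof.
move=> Ls; split=> [Lb v a vL vb|eig0].
  apply: trmx_inj; rewrite trmx0; apply: (controllable_eigenvector_eq0 Lb (a := a)).
    by rewrite -[X in _ *m X]Ls -trmx_mul vL linearZ.
  by apply/matrixP => i j; rewrite !ord1 vb mxE.
apply: controllable_of_eigenvectors => // v a vL vb.
apply: trmx_inj; rewrite trmx0; apply: (eig0 _ a).
  by rewrite -[X in X *m _]Ls -trmx_mul vL linearZ.
by rewrite trmxK vb mxE.
Qed.

(** * Laplacians of threshold graphs *)

Section Gap.
Variable R : realFieldType.
Implicit Types (x y : nat -> R) (n c : nat).

(** The inner product of x with w_c = c e_c - (e_0 + ... + e_(c-1)), the
    eigenvector that the c-th vertex contributes to every threshold graph. *)
Definition gap x c : R := c%:R * x c - \sum_(j < c) x j.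

Lemma sum_subr_cst x a c :
  \sum_(i < c) (x i - a) = \sum_(i < c) x i - c%:R * a.
Proof. by rewrite sumrB sumr_const card_ord -[a *+ c]mulr_natl. Qed.

Lemma eq_gap x y c : (forall i, (i <= c)%N -> x i = y i) -> gap x c = gap y c.
Proof.
move=> xy; rewrite /gap xy //; congr (_ - _).
by apply: eq_bigr => i _; rewrite xy // ltnW.
Qed.

Lemma gapD x y c : gap (fun i => x i + y i) c = gap x c + gap y c.
Proof. by rewrite /gap big_split /=; ring. Qed.

Lemma gapZ a x c : gap (fun i => a * x i) c = a * gap x c.
Proof. by rewrite /gap -mulr_sumr; ring. Qed.

Lemma gapB_cst x a c : gap (fun i => x i - a) c = gap x c.
Proof.
by rewrite /gap sum_subr_cst; ring.
Qed.

Lemma gap0_const x c : (forall d, (0 < d < c)%N -> gap x d = 0) ->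
  forall i, (i < c)%N -> x i = x 0.
Proof.
move=> gap0; elim/ltn_ind => -[//|i] IH ic.
have := gap0 i.+1 ic; rewrite /gap => /eqP.
rewrite subr_eq0 (eq_bigr (fun=> x 0)); last first.
  by move=> j _; apply: IH; rewrite ?ltn_ord // (ltn_trans _ ic).
by rewrite sumr_const card_ord -[x 0 *+ _]mulr_natl => /eqP /mulfI ->.
Qed.

(** The gap at c is proportional to the change of the mean when x_c joins
    x_0, ..., x_(c-1). *)
Lemma mean_telescope x n : (0 < n)%N ->
  (\sum_(i < n) x i) / n%:R =
    x 0 + \sum_(1 <= c < n) gap x c / (c%:R * c.+1%:R).
Proof.
elim: n => // -[_ _|n IH _]; first by rewrite big_ord1 big_geq // addr0 divr1.
have n0 : n.+1%:R != 0 :> R by rewrite pnatr_eq0.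
have n1 : n.+2%:R != 0 :> R by rewrite pnatr_eq0.
rewrite big_nat_recr // addrA -IH // big_ord_recr /= /gap -[n.+2%:R]natr1 in n1 *.
by field; rewrite nat1r n0 n1.
Qed.

End Gap.

Section Threshold.
Variables (R : realFieldType) (dom : nat -> bool).
Implicit Types (x y : nat -> R) (n c : nat).

(** Vertex i is joined on arrival to all earlier ones if [dom i], else to none. *)
Definition thr_adj (i j : nat) : bool := (i != j) && dom (maxn i j).

Definition thr_lap n x (i : nat) : R :=
  \sum_(j < n) (thr_adj i j)%:R * (x i - x j).

(** The eigenvalue of w_c: the arrival of c, if dominating, accounts for c + 1, and
    that of each later dominating vertex for 1. *)
Definition thr_eig n c : nat :=
  ((if dom c then c.+1 else 0) + \sum_(c.+1 <= j < n) dom j)%N.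

Lemma thr_lap_recr n x i : (i < n)%N ->
  thr_lap n.+1 x i = thr_lap n x i + (dom n)%:R * (x i - x n).
Proof.
move=> lt_in; rewrite /thr_lap big_ord_recr /= /thr_adj ltn_eqF //=.
by rewrite (maxn_idPr _) // ltnW.
Qed.

Lemma thr_lap_last n x : thr_lap n.+1 x n = (dom n)%:R * gap x n.
Proof.
rewrite /thr_lap big_ord_recr /= subrr mulr0 addr0 /gap.
transitivity ((dom n)%:R * \sum_(j < n) (x n - x j)).
  rewrite mulr_sumr; apply: eq_bigr => j _.
  by rewrite /thr_adj gtn_eqF //= (maxn_idPl _) // ltnW.
by rewrite big_split /= sumr_const card_ord -[x n *+ n]mulr_natl sumrN.
Qed.

Lemma sum_thr_lap n x : \sum_(i < n) thr_lap n x i = 0.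
Proof.
elim: n => [|n IH]; first by rewrite big_ord0.
rewrite big_ord_recr /= thr_lap_last.
under eq_bigr => i _ do rewrite thr_lap_recr //.
rewrite big_split /= IH add0r -mulr_sumr -mulrDr.
by rewrite sum_subr_cst /gap; ring.
Qed.

(** A vertex n > c adds to the Laplacian, on the earlier vertices, a multiple of
    the identity and a constant vector; gaps ignore constants, so the eigenvalue
    grows by [dom n]. The graph that ends at c starts the induction. *)
Lemma gap_thr_lap n x c : (c < n)%N ->
  gap (thr_lap n x) c = (thr_eig n c)%:R * gap x c.
Proof.
elim: n => // n IH; rewrite ltnS leq_eqVlt => /predU1P[->|lt_cn].
  rewrite /thr_eig big_geq // addn0 {1}/gap thr_lap_last.
  under eq_bigr => i _ do rewrite thr_lap_recr //.
  rewrite big_split /= sum_thr_lap -mulr_sumr sum_subr_cst.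
  rewrite /gap; case: (dom n); last by rewrite !mul0r; ring.
  by rewrite mulr1n -natr1; ring.
rewrite (eq_gap (y := fun i => thr_lap n x i + (dom n)%:R * (x i - x n))).
  rewrite gapD IH // gapZ gapB_cst -mulrDl -natrD; congr (_%:R * _).
  by rewrite /thr_eig big_nat_recr //= addnA.
by move=> i ic; rewrite thr_lap_recr // (leq_ltn_trans ic).
Qed.

End Threshold.

Section BinarySums.
Variables (R : realFieldType) (b : nat -> R).
Hypothesis b01 : forall i, b i = 0 \/ b i = 1.
Hypothesis b_twin : b 0 + b 1 = 1.

(** Exactly one of the first two terms is 1, so neither none nor all of the first c
    terms are. *)
Lemma binary_sum c : (1 < c)%N ->
  exists2 t : nat, \sum_(i < c) b i = t%:R & (0 < t < c)%N.
Proof.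
elim: c => // -[//|[|c] IH _].
  by exists 1%N => //; rewrite big_ord_recr big_ord1.
have [//|t tE lt_t] := IH.
rewrite big_ord_recr /= tE; case: (b01 c.+2) => ->.
  by exists t; [rewrite addr0|lia].
by exists t.+1; [rewrite natr1|lia].
Qed.

End BinarySums.

(** * Spectrum for alternating dominating vertices *)

(** Dominating and isolated vertices alternate, the last vertex n - 1 being
    dominating. *)
Definition alt (n i : nat) : bool := ~~ odd (n.-1 - i).

Lemma thr_eig_alt n c : (c < n)%N ->
  thr_eig (alt n) n c = ((if alt n c then c.+1 else 0) + (n - c)./2)%N.
Proof.
move=> lt_cn; congr (_ + _)%N.
suff S d : (d < n)%N -> (\sum_(n - d <= j < n) alt n j = d.+1./2)%N.
  have -> : c.+1 = (n - (n - c.+1))%N by lia.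
  by rewrite S; last lia; congr _./2; lia.
elim: d => [|d IH] dn; first by rewrite subn0 big_geq.
rewrite big_ltn; last lia.
have -> : (n - d.+1).+1 = (n - d)%N by lia.
by rewrite IH /alt; lia.
Qed.

Lemma thr_eig_alt_gt0 n c : (c < n)%N -> (0 < thr_eig (alt n) n c)%N.
Proof. by move=> cn; rewrite thr_eig_alt // /alt; case: ifP; lia. Qed.

Lemma thr_eig_alt_inj n c d : (0 < c < n)%N -> (0 < d < n)%N ->
  thr_eig (alt n) n c = thr_eig (alt n) n d -> c = d.
Proof.
move=> /andP[c0 cn] /andP[d0 dn]; rewrite !thr_eig_alt // /alt.
by case: ifP => C; case: ifP => D E; lia.
Qed.

Lemma thr_eig_alt_onto n v : (0 < v <= n)%N -> v != uphalf n ->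
  exists2 c, (0 < c < n)%N & thr_eig (alt n) n c = v.
Proof.
move=> vn v_neq.
(* The larger eigenvalues are (n + c + 1) / 2, from the dominating vertices; the
   smaller ones are (n - c) / 2. *)
pose c := if (uphalf n < v)%N then (v.*2 - n.+1)%N else (n - v.*2)%N.
have cn : (0 < c < n)%N by rewrite /c; case: ifP; lia.
exists c => //; rewrite thr_eig_alt; last by case/andP: cn.
by rewrite /alt /c; case: ifP; case: ifP; lia.
Qed.

Lemma thr_eig_alt_neq n c : (0 < c < n)%N -> thr_eig (alt n) n c != uphalf n.
Proof.
by move=> cn; rewrite thr_eig_alt /alt; try case: ifP; lia.
Qed.

(** An eigenvector of the joined graph satisfies the eigenvector equation of each
    part up to a term r supported at the end of the bridge. *)
Lemma forced_gap (R : realFieldType) (n : nat) (x r : nat -> R) (lam : R) (c : nat) :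
  (forall i, (i < n)%N -> thr_lap (alt n) n x i = lam * x i + r i) ->
  (c < n)%N -> ((thr_eig (alt n) n c)%:R - lam) * gap x c = gap r c.
Proof.
move=> xE cn; have := gap_thr_lap (alt n) x cn.
rewrite (@eq_gap _ _ (fun i => lam * x i + r i) c); last first.
  by move=> i ic; rewrite xE // (leq_ltn_trans ic).
by rewrite gapD gapZ mulrBl => <-; rewrite addrC addKr.
Qed.

Lemma forced_sum (R : realFieldType) (n : nat) (x r : nat -> R) (lam : R) :
  (forall i, (i < n)%N -> thr_lap (alt n) n x i = lam * x i + r i) ->
  lam * (\sum_(i < n) x i) = - \sum_(i < n) r i.
Proof.
move=> xE; apply/eqP; rewrite -addr_eq0 mulr_sumr -big_split /=.
rewrite -[X in _ == X](sum_thr_lap (alt n) n x); apply/eqP.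
by apply: eq_bigr => i _; rewrite xE.
Qed.

Section Spectra.
Variables (R : realFieldType) (b : nat -> R).
Hypothesis b01 : forall i, b i = 0 \/ b i = 1.
Hypothesis b_twin : b 0 + b 1 = 1.

(** The eigenvalues being distinct, at most one of the sum of x and its gaps is
    nonzero, so x is a multiple of 1 or of some w_c; none of these is orthogonal
    to b. *)
Lemma alt_eigenvector_eq0 (n : nat) (x : nat -> R) (lam : R) : (1 < n)%N ->
  (forall i, (i < n)%N -> thr_lap (alt n) n x i = lam * x i) ->
  \sum_(i < n) b i * x i = 0 -> forall i, (i < n)%N -> x i = 0.
Proof.
move=> n1 xE bx.
have xE0 i : (i < n)%N -> thr_lap (alt n) n x i = lam * x i + 0.
  by move=> /xE ->; rewrite addr0.
have gE c : (c < n)%N -> ((thr_eig (alt n) n c)%:R - lam) * gap x c = 0.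
  by move=> /(forced_gap xE0) ->; rewrite /gap big1 // mulr0 subr0.
have sE : lam * (\sum_(i < n) x i) = 0.
  by rewrite (forced_sum xE0) big1 // oppr0.
have [/existsP[c /andP[c0 gc]]|/existsPn gap_eq0] :=
    boolP [exists c : 'I_n, (0 < c)%N && (gap x c != 0)]; last first.
  have xc : forall i, (i < n)%N -> x i = x 0.
    apply: (@gap0_const _ x n) => d /andP[d0 dn]; apply/eqP/negPn.
    by have := gap_eq0 (Ordinal dn); rewrite d0.
  have [t tE /andP[t0 _]] := binary_sum b01 b_twin n1.
  move: bx; rewrite (eq_bigr (fun i : 'I_n => b i * x 0)) => [|i _]; last first.
    by rewrite (xc i).
  rewrite -mulr_suml tE => /eqP; rewrite mulf_eq0 pnatr_eq0 eqn0Ngt t0 /=.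
  by move=> /eqP x0 i /xc ->.
have cn := ltn_ord c.
have lamE : lam = (thr_eig (alt n) n c)%:R.
  apply/eqP; rewrite eq_sym -subr_eq0.
  by have /eqP := gE c cn; rewrite mulf_eq0 (negPf gc) orbF.
have gd d : (0 < d < n)%N -> d != c -> gap x d = 0.
  move=> /andP[d0 dn] dc; have /eqP := gE d dn; rewrite mulf_eq0 => /orP[|/eqP //].
  rewrite lamE subr_eq0 eqr_nat => /eqP /thr_eig_alt_inj dcE.
  by case/eqP: dc; apply: dcE; rewrite ?d0 ?c0.
have xlt : forall i, (i < c)%N -> x i = x 0.
  apply: (@gap0_const _ x c) => d /andP[d0 dc]; apply: gd.
    by rewrite d0 (ltn_trans dc).
  by rewrite ltn_eqF.
have Sn : \sum_(i < n) x i = 0.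
  move/eqP: sE; rewrite mulf_eq0 lamE pnatr_eq0 => /orP[|/eqP //].
  by rewrite eqn0Ngt thr_eig_alt_gt0.
(* Above c the gaps vanish, so the partial sums vanish from n down to c. *)
have Sd e : (e < n - c)%N -> \sum_(i < n - e) x i = 0.
  elim: e => [_|e IH en]; first by rewrite subn0.
  have ne : (n - e)%N = (n - e.+1).+1 by lia.
  have : \sum_(i < n - e) x i = 0 by apply: IH; lia.
  have : gap x (n - e.+1)%N = 0 by apply: gd; lia.
  rewrite ne big_ord_recr /= /gap; set d := (n - e.+1)%N => G S.
  have d1 : d.+1%:R != 0 :> R by rewrite pnatr_eq0.
  apply: (mulfI d1); rewrite mulr0 -natr1.
  have -> : (d%:R + 1) * \sum_(i < d) x i = d%:R * (\sum_(i < d) x i + x d) -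
      (d%:R * x d - \sum_(i < d) x i) by ring.
  by rewrite S G; ring.
have xgt i : (c < i < n)%N -> x i = 0.
  move=> ci; have := Sd (n - i.+1)%N; have := Sd (n - i)%N.
  have -> : (n - (n - i))%N = i by lia.
  have -> : (n - (n - i.+1))%N = i.+1 by lia.
  move=> Si Si1; have := Si1 _; rewrite big_ord_recr /= Si; last lia.
  by rewrite add0r; apply; lia.
have xcE : x c = - c%:R * x 0.
  have := Sd (n - c.+1)%N; have -> : (n - (n - c.+1))%N = c.+1 by lia.
  rewrite big_ord_recr /= (eq_bigr (fun=> x 0)) => [|i _]; last exact: xlt.
  rewrite sumr_const card_ord -[x 0 *+ _]mulr_natl => S.
  have /S : (n - c.+1 < n - c)%N by lia.
  by lra.
have x0 : x 0 != 0.
  apply: contra_neq gc => x0; rewrite /gap xcE x0 !mulr0 sub0r big1 ?oppr0 //.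
  by move=> i _; rewrite xlt.
suff /eqP : (\sum_(i < c) b i - c%:R * b c) * x 0 = 0.
  rewrite mulf_eq0 (negPf x0) orbF => /eqP sb; exfalso.
  move: sb; case: (ltngtP c 1) c0 => // [c1|c1] _.
    have [t -> /andP[t0 tc]] := binary_sum b01 b_twin c1.
    case: (b01 c) => ->; rewrite ?mulr0 ?mulr1 => /eqP.
      by rewrite subr0 pnatr_eq0 eqn0Ngt t0.
    by rewrite subr_eq0 eqr_nat ltn_eqF.
  rewrite c1 big_ord1 => b01E.
  by have := b_twin; case: (b01 0) => e0; case: (b01 1) => e1; lra.
rewrite -[RHS]bx -(big_mkord xpredT (fun i => b i * x i)).
rewrite (@big_cat_nat _ _ _ c.+1) //=.
rewrite [X in _ = _ + X]big_nat_cond [X in _ = _ + X]big1; last first.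
  by move=> i /andP[ci _]; rewrite xgt ?mulr0.
rewrite addr0 big_nat_recr //= big_mkord xcE.
rewrite [X in _ = X + _](eq_bigr (fun i : 'I_c => b i * x 0)) => [|i _]; last first.
  by rewrite xlt.
by rewrite -mulr_suml mulNr; ring.
Qed.
End Spectra.

(** * Eigenvalues across a bridge *)

Lemma thr_eig_alt_last n : (0 < n)%N -> thr_eig (alt n) n n.-1 = n.
Proof. by move=> n0; rewrite thr_eig_alt /alt; try case: ifP; lia. Qed.

Lemma thr_eig_alt_ltn n c : (c < n.-1)%N -> (thr_eig (alt n) n c < n)%N.
Proof. by move=> cn; rewrite thr_eig_alt /alt; try case: ifP; lia. Qed.

Lemma sum_inv_consecutive (R : realFieldType) (n : nat) : (0 < n)%N ->
  \sum_(1 <= c < n) (c%:R * c.+1%:R)^-1 = 1 - n%:R^-1 :> R.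
Proof.
elim: n => // -[_ _|n IH _]; first by rewrite big_geq // invr1 subrr.
rewrite big_nat_recr //= IH // -[n.+2%:R]natr1.
by field; rewrite nat1r !pnatr_eq0 natr1 pnatr_eq0.
Qed.

Lemma thr_lapZ (R : realFieldType) dom n (a : R) x i :
  thr_lap dom n (fun j => a * x j) i = a * thr_lap dom n x i.
Proof.
by rewrite /thr_lap mulr_sumr; apply: eq_bigr => j _; rewrite -mulrBr mulrCA.
Qed.

Lemma sum_ord_pred (R : nmodType) (F : nat -> R) (m : nat) : (0 < m)%N ->
  \sum_(i < m) F i = \sum_(i < m.-1) F i + F m.-1.
Proof. by case: m => // m _; rewrite big_ord_recr. Qed.

(** The eigenvector equations of the joined graph, in the orders of construction of
    its two parts and with the difference along the bridge scaled to 1. *)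
Section Bridge.
Variables (R : realFieldType) (m n : nat) (x y : nat -> R) (lam : R).
Hypotheses (m1 : (1 < m)%N) (n1 : (1 < n)%N) (mn : (m <= n.+1)%N).
Hypothesis xE : forall i, (i < m)%N ->
  thr_lap (alt m) m x i = lam * x i + - (i == m.-1)%:R.
Hypothesis yE : forall i, (i < n)%N ->
  thr_lap (alt n) n y i = lam * y i + (i == 0)%:R.
Hypothesis bridge : x m.-1 - y 0 = 1.

Let sum_x : lam * (\sum_(i < m) x i) = 1.
Proof.
rewrite (forced_sum xE) sumrN opprK.
rewrite (sum_ord_pred (fun i => (i == m.-1)%:R)) ?(ltnW m1) //.
by rewrite eqxx big1 ?add0r // => i _; rewrite ltn_eqF.
Qed.

Let sum_y : lam * (\sum_(i < n) y i) = - 1.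
Proof.
rewrite (forced_sum yE) -(prednK (ltnW n1)) big_ord_recl /= big1 ?addr0 //.
Qed.

Let gap_x_last : (m%:R - lam) * gap x m.-1 = - m.-1%:R.
Proof.
have := forced_gap xE (_ : (m.-1 < m)%N); rewrite thr_eig_alt_last; last lia.
move=> ->; last lia.
rewrite /gap eqxx mulrN1 big1 ?subr0 // => i _.
by rewrite ltn_eqF ?oppr0.
Qed.

Let gap_x c : (c < m.-1)%N ->
  ((thr_eig (alt m) m c)%:R - lam) * gap x c = 0.
Proof.
move=> cm; rewrite (forced_gap xE); last lia.
rewrite /gap ltn_eqF // oppr0 mulr0 sub0r big1 ?oppr0 // => i _.
by rewrite ltn_eqF ?oppr0 // (ltn_trans (ltn_ord i)).
Qed.

Let gap_y c : (0 < c < n)%N ->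
  ((thr_eig (alt n) n c)%:R - lam) * gap y c = - 1.
Proof.
case: c => // c /= cn; rewrite (forced_gap yE) // /gap mulr0 sub0r.
by rewrite big_ord_recl big1 ?addr0.
Qed.

(** Pairing the second equation with w_c shows that lam is none of the eigenvalues
    of the second graph, which cover 1, ..., n except the ceiling of n / 2. *)
Lemma bridge_eigenvalue_eq (v : nat) :
  lam = v%:R -> (0 < v < m)%N -> v = uphalf n.
Proof.
move=> lamE vm; apply/eqP/negPn/negP => v_neq.
have [|c cn cv] := thr_eig_alt_onto _ v_neq; first lia.
have := gap_y cn; rewrite cv lamE subrr mul0r => /eqP.
by rewrite eq_sym oppr_eq0 oner_eq0.
Qed.

(** The first equation makes x nonpositive at the bridge. In the second graph the
    eigenvalues of the w_c differ from lam by at least 1, so the gaps of y are at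
    most 1, and [mean_telescope] gives y 0 > - 1 when n > 2; for n = 2 one finds
    y 0 = 0. *)
Lemma bridge_eigenvalue_neq : (uphalf n < m)%N -> lam <> (uphalf n)%:R.
Proof.
set s := uphalf n => sm lamE.
have s1 : 1 <= s%:R :> R by rewrite ler1n /s; lia.
have s0 : 0 < s%:R :> R := lt_le_trans ltr01 s1.
have n0 : 0 < n%:R :> R by rewrite ltr0n; lia.
have m0 : 0 < m%:R :> R by rewrite ltr0n; lia.
have ms : 0 < m%:R - s%:R :> R by rewrite subr_gt0 ltr_nat.
have mE : m%:R = m.-1%:R + 1 :> R by rewrite natr1 prednK // ltnW.
have sum_xE : s%:R * \sum_(i < m) x i = 1 by rewrite -lamE sum_x.
have sum_yE : s%:R * \sum_(i < n) y i = - 1 by rewrite -lamE sum_y.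
have x_last : x m.-1 <= 0.
  have mx : m%:R * x m.-1 = \sum_(i < m) x i + gap x m.-1.
    by rewrite (sum_ord_pred x (ltnW m1)) /gap mE; ring.
  have E : (s%:R * (m%:R - s%:R) * m%:R) * x m.-1 = m%:R * (1 - s%:R).
    rewrite -mulrA mx mulrDr mulrAC sum_xE -mulrA -lamE gap_x_last lamE mE; ring.
  rewrite -(pmulr_rle0 _ (_ : 0 < s%:R * (m%:R - s%:R) * m%:R)) ?E ?mulr_gt0 //.
  by rewrite mulr_ge0_le0 ?subr_le0 // ltW.
have gap_le1 c : (0 < c < n)%N -> gap y c <= 1.
  move=> cn; have := gap_y cn; rewrite lamE.
  have := thr_eig_alt_neq cn; rewrite -/s neq_ltn => /orP[] lt_s.
    have : (thr_eig (alt n) n c)%:R + 1 <= s%:R :> R by rewrite natr1 ler_nat.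
    by move=> ? ?; nra.
  have : s%:R + 1 <= (thr_eig (alt n) n c)%:R :> R by rewrite natr1 ler_nat.
  by move=> ? ?; nra.
have [n2|n3] := leqP n 2.
  have n2E : n = 2%N by lia.
  have sE : s = 1%N by rewrite /s n2E.
  have := gap_y (c := 1); rewrite n2E thr_eig_alt // /alt /= lamE sE => /(_ isT).
  move: sum_yE; rewrite sE n2E /gap !big_ord_recr big_ord0 /=.
  by move: bridge x_last => ? ? ? ?; lra.
have s2 : 2 <= s%:R :> R by rewrite ler_nat /s; lia.
have tele := mean_telescope y (ltnW n1).
have Sle : \sum_(1 <= c < n) gap y c / (c%:R * c.+1%:R) <= 1 - n%:R^-1.
  rewrite -sum_inv_consecutive ?(ltnW n1) // !big_nat; apply: ler_sum => c cn.
  by rewrite ler_piMl ?gap_le1 // invr_ge0 mulr_ge0.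
have Qlt : - n%:R^-1 < (\sum_(i < n) y i) / n%:R.
  rewrite -mulN1r ltr_pM2r ?invr_gt0 //.
  by move: sum_yE s2; set Q := \sum_(i < n) y i => ? ?; nra.
by move: bridge x_last; lra.
Qed.

Variable b : nat -> R.
Hypothesis b01 : forall i, b i = 0 \/ b i = 1.
Hypothesis b_twin : b 0 + b 1 = 1.
Hypothesis bx : \sum_(i < m) b i * x i = 0.

(** Either some w_c with c < m - 1 pairs with x to a nonzero value, and lam is its
    eigenvalue, or x is constant off the dominating vertex. In that case
    orthogonality to b reads t = (lam - 1) b_(m-1), where t is the number of ones
    of b before the last entry. *)
Lemma bridge_eigenvalue_nat : exists2 v, lam = v%:R & (0 < v < m)%N.
Proof.
have [/existsP[c /andP[c0 gc]]|/existsPn gap_eq0] :=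
    boolP [exists c : 'I_m.-1, (0 < c)%N && (gap x c != 0)].
  exists (thr_eig (alt m) m c).
    apply/eqP; rewrite eq_sym -subr_eq0.
    by have /eqP := gap_x (ltn_ord c); rewrite mulf_eq0 (negPf gc) orbF.
  by rewrite thr_eig_alt_ltn // thr_eig_alt_gt0 // (leq_trans (ltn_ord c)) // leq_pred.
have xc : forall i, (i < m.-1)%N -> x i = x 0.
  apply: (@gap0_const _ x m.-1) => d /andP[d0 dm]; apply/eqP/negPn.
  by have := gap_eq0 (Ordinal dm); rewrite d0.
have S : \sum_(i < m.-1) x i = m.-1%:R * x 0.
  rewrite (eq_bigr (fun=> x 0)) => [|i _]; last exact: xc.
  by rewrite sumr_const card_ord -[x 0 *+ _]mulr_natl.
have Sm : \sum_(i < m) x i = m.-1%:R * x 0 + x m.-1.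
  by rewrite (sum_ord_pred x (ltnW m1)) S.
have mE : m%:R = m.-1%:R + 1 :> R by rewrite natr1 prednK // ltnW.
have m1_neq0 : m.-1%:R != 0 :> R by rewrite pnatr_eq0; lia.
have x_last : x m.-1 = (1 - lam) * x 0.
  have m_neq0 : m%:R != 0 :> R by rewrite pnatr_eq0; lia.
  have : (m%:R - lam) * (x m.-1 - x 0) = - 1.
    apply: (mulfI m1_neq0); rewrite mulrN1 -gap_x_last /gap S; ring.
  have := sum_x; rewrite Sm mE => E1 E2.
  by apply: (mulfI m_neq0); rewrite mE; lra.
have x0 : x 0 != 0.
  apply/eqP => x0; have := sum_x; rewrite Sm x_last x0 !mulr0 addr0 mulr0.
  by move/eqP; rewrite eq_sym oner_eq0.
have tE : \sum_(i < m.-1) b i = (lam - 1) * b m.-1.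
  apply: (mulIf x0); rewrite mulr_suml.
  have := bx; rewrite (sum_ord_pred (fun i => b i * x i) (ltnW m1)) x_last.
  rewrite (eq_bigr (fun i : 'I_m.-1 => b i * x 0)) => [|i _]; last by rewrite xc.
  by move=> E; lra.
have [m2|m3] := leqP m 2.
  have m2E : m = 2 by lia.
  move: tE; rewrite m2E big_ord1 /=.
  case: (b01 0) => e0; case: (b01 1) => e1; move: b_twin; rewrite e0 e1 => tw E; try lra.
  by exists 1%N => //; lra.
have [|t tE' /andP[t0 tm]] := binary_sum b01 b_twin (c := m.-1); first lia.
move: tE; rewrite tE'; case: (b01 m.-1) => ->.
  by rewrite mulr0 => /eqP; rewrite pnatr_eq0 eqn0Ngt t0.
rewrite mulr1 => tl; exists t.+1; last lia.
by rewrite -natr1 tl subrK.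
Qed.

Lemma bridge_absurd : False.
Proof.
have [v lamE vm] := bridge_eigenvalue_nat.
have vE := bridge_eigenvalue_eq lamE vm; rewrite vE in lamE vm.
by apply: bridge_eigenvalue_neq lamE; case/andP: vm.
Qed.

End Bridge.

Lemma joined_eigenvector_eq0 (R : realFieldType) (m n : nat) (b x y : nat -> R)
    (lam : R) :
  (1 < m)%N -> (1 < n)%N -> (m <= n.+1)%N ->
  (forall i, b i = 0 \/ b i = 1) -> b 0 + b 1 = 1 ->
  (forall i, (i < m)%N ->
     thr_lap (alt m) m x i = lam * x i - (i == m.-1)%:R * (x m.-1 - y 0)) ->
  (forall i, (i < n)%N ->
     thr_lap (alt n) n y i = lam * y i + (i == 0)%:R * (x m.-1 - y 0)) ->
  \sum_(i < m) b i * x i = 0 ->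
  (forall i, (i < m)%N -> x i = 0) /\ (forall i, (i < n)%N -> y i = 0).
Proof.
move=> m1 n1 mn b01 b_twin xE yE bx.
have [d0|d0] := eqVneq (x m.-1 - y 0) 0.
  have x0 : forall i, (i < m)%N -> x i = 0.
    apply: (alt_eigenvector_eq0 b01 b_twin m1 (lam := lam)) => // i im.
    by rewrite xE // d0 mulr0 subr0.
  (* y vanishes at the twin vertex 0, so it is orthogonal to its indicator. *)
  split=> //; pose b' (i : nat) : R := (i == 0)%:R.
  apply: (@alt_eigenvector_eq0 _ b' _ _ n y lam) => //.
  - by move=> i; rewrite /b'; case: (i == 0); [right|left].
  - by rewrite /b' /= addr0.
  - by move=> i im; rewrite yE // d0 mulr0 addr0.
  rewrite -(prednK (ltnW n1)) big_ord_recl /b' /= mul1r big1 ?addr0; last first.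
    by move=> i _; rewrite mul0r.
  by move: d0; rewrite x0 ?sub0r; [move/eqP; rewrite oppr_eq0 => /eqP|lia].
exfalso; set d := x m.-1 - y 0 in d0.
apply: (@bridge_absurd _ m n (fun i => d^-1 * x i) (fun i => d^-1 * y i) lam
  m1 n1 mn _ _ _ b b01 b_twin).
- move=> i im; rewrite thr_lapZ xE // -/d mulrBr; congr (_ - _); first by rewrite mulrCA.
  by rewrite mulrCA mulVf ?mulr1.
- move=> i im; rewrite thr_lapZ yE // -/d mulrDr; congr (_ + _); first by rewrite mulrCA.
  by rewrite mulrCA mulVf ?mulr1.
- by rewrite -mulrBr mulVf.
under eq_bigr do rewrite mulrCA.
by rewrite -mulr_sumr bx mulr0.
Qed.

(** * Antiregular graphs in order of construction *)

Lemma entry_ord (R : realType) (n : nat) (v : 'cV[R]_n) i (lt_in : (i < n)%N) :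
  entry v i.+1 = v (Ordinal lt_in) 0.
Proof. by rewrite -entryE. Qed.

Lemma dot_entry (R : realType) (n : nat) (v w : 'cV[R]_n) :
  (v^T *m w) 0 0 = \sum_(i < n) entry w i.+1 * entry v i.+1.
Proof. by rewrite mxE; apply: eq_bigr => i _; rewrite !entryE mxE mulrC. Qed.

Lemma degreeE (R : pzRingType) (n : nat) (e : rel 'I_n) i :
  (degree e i)%:R = \sum_j (e i j)%:R :> R.
Proof.
rewrite /degree cardsE -sum1_card natr_sum big_mkcond; apply: eq_bigr => j _.
by rewrite [X in if X then _ else _]unfold_in; case: (e i j).
Qed.

Lemma laplacianE (R : pzRingType) (n : nat) (e : rel 'I_n) (v : 'cV[R]_n) i :
  (laplacian R e *m v) i 0 = \sum_j (e i j)%:R * (v i 0 - v j 0).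
Proof.
rewrite mxE; under eq_bigr do rewrite mxE mulrBl.
under [RHS]eq_bigr do rewrite mulrBr.
rewrite !sumrB -mulr_suml -degreeE; congr (_ - _).
rewrite (bigD1 i) //= eqxx big1 ?addr0 // => j ji.
by rewrite eq_sym (negPf ji) mul0r.
Qed.

(** The vertex, numbered from 0 by nonincreasing degree, that is added at time t.
    The flag a exchanges the twins, added at times 0 and 1: it lets the bridge end
    at time 0 in the second graph, and the dominating vertex of the first graph
    come last even when that graph has only two vertices. *)
Definition build_order (a : bool) (n t : nat) : nat :=
  if (t < 2)%N then ((uphalf n).-1 + (t != a))%N
  else if odd (n.-1 - t) then (n.-1 - (n.-2 - t)./2)%N else (n.-1 - t)./2.

Lemma build_order_lt a n t : (1 < n)%N -> (t < n)%N -> (build_order a n t < n)%N.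
Proof.
by rewrite /build_order => n1 tn; case: a; case: ifP; try case: ifP; lia.
Qed.

Lemma build_order_inj a n t u : (1 < n)%N -> (t < n)%N -> (u < n)%N ->
  build_order a n t = build_order a n u -> t = u.
Proof.
rewrite /build_order => n1 tn un.
by case: a; case: (ltnP t 2) => t2; case: (ltnP u 2) => u2;
  try (case: ifP => pt); try (case: ifP => pu); lia.
Qed.

Lemma build_order_adj a n t u : (1 < n)%N -> (t < n)%N -> (u < n)%N ->
  (build_order a n t != build_order a n u) &&
    ((build_order a n t).+1 + (build_order a n u).+1 <= n.+1)%N =
  thr_adj (alt n) t u.
Proof.
move=> n1 tn un; rewrite /thr_adj.
have -> : (build_order a n t != build_order a n u) = (t != u).
  by congr (~~ _); apply/eqP/eqP => [/(build_order_inj n1 tn un)|->].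
have [//|tu] := eqVneq t u; rewrite /= /alt /build_order.
by case: a; case: (ltnP t 2) => t2; case: (ltnP u 2) => u2;
  try (case: ifP => pt); try (case: ifP => pu); lia.
Qed.

Lemma build_order_last n : (1 < n)%N -> build_order (~~ odd n) n n.-1 = 0%N.
Proof.
by case: n => [|[|[|n]]] // _; rewrite /build_order /= subnn.
Qed.

Section Transport.
Variables (R : realType) (a : bool) (n : nat).
Hypothesis n1 : (1 < n)%N.
Let s := build_order a n.

Let s_ord (t : 'I_n) : 'I_n := Ordinal (build_order_lt a n1 (ltn_ord t)).

Let s_ord_inj : injective s_ord.
Proof.
move=> t u /(congr1 val) /= E; apply: val_inj.
exact: build_order_inj n1 (ltn_ord t) (ltn_ord u) E.
Qed.

Lemma sum_build_order (F : nat -> R) :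
  \sum_(i < n) F i = \sum_(t < n) F (build_order a n t).
Proof. by rewrite (reindex_inj s_ord_inj). Qed.

Lemma build_order_onto (i : 'I_n) :
  exists2 t, (t < n)%N & build_order a n t = i.
Proof. by exists (invF s_ord_inj i) => //; rewrite -[in RHS](f_invF s_ord_inj i). Qed.

Lemma entry_laplacian_antireg (v : 'cV[R]_n) t : (t < n)%N ->
  entry (laplacian R (@antireg n) *m v) (s t).+1 =
  thr_lap (alt n) n (fun u => entry v (s u).+1) t.
Proof.
move=> tn; rewrite (entry_ord _ (build_order_lt a n1 tn)) laplacianE.
rewrite /thr_lap (reindex_inj s_ord_inj); apply: eq_bigr => u _.
by rewrite -(build_order_adj a) // -!entryE.
Qed.

Lemma entry_build_order_eq0 (v : 'cV[R]_n) :
  (forall t, (t < n)%N -> entry v (s t).+1 = 0) -> v = 0.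
Proof.
move=> v0; apply/colP => i; have [t tn ti] := build_order_onto i.
by rewrite mxE -entryE -ti v0.
Qed.

End Transport.

Lemma laplacian_sym (R : pzRingType) n (e : rel 'I_n) : symmetric e ->
  (laplacian R e)^T = laplacian R e.
Proof.
move=> es; apply/matrixP => i j; rewrite !mxE es eq_sym.
by have [->|] := eqVneq i j; rewrite ?mulr0n.
Qed.

Lemma entryD (R : realType) n (v w : 'cV[R]_n) i :
  entry (v + w) i = entry v i + entry w i.
Proof. by rewrite /entry; case: insub => [j|]; rewrite ?mxE ?addr0. Qed.

Lemma entryZ (R : realType) n a (v : 'cV[R]_n) i : entry (a *: v) i = a * entry v i.
Proof. by rewrite /entry; case: insub => [j|]; rewrite ?mxE ?mulr0. Qed.

Lemma entry_basis_vec (R : realType) n p i : (i < n)%N ->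
  entry (basis_vec R n p) i.+1 = (i.+1 == p)%:R.
Proof. by move=> lt_in; rewrite (entry_ord _ lt_in) mxE. Qed.

Lemma binary_entry (R : realType) n (v : 'cV[R]_n) : binary v ->
  forall i, entry v i = 0 \/ entry v i = 1.
Proof. by move=> vb i; rewrite /entry; case: insub => [j|]; [exact: vb|left]. Qed.

Lemma entry_build_order_twin (R : realType) a n (v : 'cV[R]_n) : (1 < n)%N ->
  entry v (build_order a n 0).+1 + entry v (build_order a n 1).+1 =
  entry v (uphalf n) + entry v (uphalf n).+1.
Proof.
move=> n1; have uE : (uphalf n).-1.+1 = uphalf n by lia.
rewrite /build_order /=; case: a => /=; rewrite ?addn0 ?addn1 uE //.
exact: addrC.
Qed.

Lemma antireg_eigenvector_eq0 (R : realType) n (b v : 'cV[R]_n) (lam : R) :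
  (1 < n)%N -> binary b -> entry b (uphalf n) + entry b (uphalf n).+1 = 1 ->
  laplacian R (@antireg n) *m v = lam *: v -> (v^T *m b) 0 0 = 0 -> v = 0.
Proof.
move=> n1 bb b1 vL vb; apply: (@entry_build_order_eq0 _ false _ n1).
have b01 t := binary_entry bb (build_order false n t).+1.
apply: (alt_eigenvector_eq0 b01 _ n1 (lam := lam)).
- by rewrite entry_build_order_twin.
- by move=> t tn; rewrite -entry_laplacian_antireg // vL entryZ.
rewrite -(sum_build_order false n1 (fun i => entry b i.+1 * entry v i.+1)).
by rewrite -dot_entry.
Qed.

Lemma joined_antireg_sym k : symmetric (@joined_antireg k).
Proof.
move=> i j; rewrite /joined_antireg.
by case: (fintype.split i) => ?; case: (fintype.split j) => ? //; exact: antireg_sym.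
Qed.

(** * Eigenvectors of the joined graph *)

Lemma bridge_vecE (R : realType) m n q : (0 < m)%N -> (0 < q)%N ->
  basis_vec R (m + n) 1 - basis_vec R (m + n) (m + q) =
  col_mx (basis_vec R m 1) (- basis_vec R n q).
Proof.
move=> m0 q0; apply/colP => l; rewrite -[l]splitK; case: (fintype.split l) => j /=.
  rewrite col_mxEu !mxE /=; have -> : (j.+1 == m + q)%N = false.
    by move: (ltn_ord j); lia.
  by rewrite subr0.
rewrite col_mxEd !mxE /=; have -> : ((m + j).+1 == 1)%N = false by lia.
by rewrite -addnS eqn_add2l sub0r.
Qed.

Lemma basis_vec_dot (R : realType) n p (v : 'cV[R]_n) : (0 < p <= n)%N ->
  (basis_vec R n p)^T *m v = (entry v p)%:M.
Proof.
case: p => // p /= pn; apply/matrixP => i j.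
rewrite !ord1 !mxE mulr1n (bigD1 (Ordinal pn)) //= !mxE eqxx mul1r (entry_ord _ pn).
rewrite big1 ?addr0 // => l lp; rewrite !mxE eqSS.
by rewrite -[_ == _]/(l == Ordinal pn) (negPf lp) mul0r.
Qed.

Lemma laplacian_joined_mul (R : realType) k (x : 'cV[R]_(uphalf k))
    (y : 'cV[R]_(k./2)) (d := entry x 1 - entry y (uphalf k./2)) : (4 <= k)%N ->
  laplacian R (@joined_antireg k) *m col_mx x y =
  col_mx (laplacian R (@antireg (uphalf k)) *m x + d *: basis_vec R _ 1)
         (laplacian R (@antireg k./2) *m y - d *: basis_vec R _ (uphalf k./2)).
Proof.
move=> hk; rewrite laplacian_joined_antireg // bridge_vecE; try lia.
rewrite mulmxDl mul_block_col !mul0mx addr0 add0r -mulmxA tr_col_mx mul_row_col.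
rewrite linearN mulNmx !basis_vec_dot; try lia.
rewrite -raddfB -/d mul_mx_scalar scale_col_mx add_col_mx.
by rewrite scalerN.
Qed.

(** With the flags chosen below, the bridge joins the last vertex of the first
    order of construction to the first vertex of the second. *)
Lemma joined_antireg_eigenvector_eq0 (R : realType) k (bbar : 'cV[R]_(uphalf k))
    (v : 'cV[R]_(uphalf k + k./2)) (lam : R) :
  (4 <= k)%N -> binary bbar ->
  entry bbar (uphalf (uphalf k)) + entry bbar (uphalf (uphalf k)).+1 = 1 ->
  laplacian R (@joined_antireg k) *m v = lam *: v ->
  (v^T *m col_mx bbar (0 : 'cV_(k./2))) 0 0 = 0 -> v = 0.
Proof.
move=> hk bb b1; rewrite -[v]vsubmxK; set x := usubmx v; set y := dsubmx v.
have m1 : (1 < uphalf k)%N by lia.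
have n1 : (1 < k./2)%N by lia.
rewrite laplacian_joined_mul // scale_col_mx => /eq_col_mx[].
rewrite tr_col_mx mul_row_col mulmx0 addr0.
set d := entry x 1 - _ => xE yE xb.
pose sx := build_order (~~ odd (uphalf k)) (uphalf k); pose sy := build_order false k./2.
have sx_last : sx (uphalf k).-1 = 0%N by exact: build_order_last.
have sx1 : (sx (uphalf k).-1).+1 = 1%N by rewrite sx_last.
have sy0 : (sy 0).+1 = uphalf k./2 by rewrite /sy /build_order /=; lia.
have dE : d = entry x (sx (uphalf k).-1).+1 - entry y (sy 0).+1 by rewrite sx_last sy0.
have [|||||x0 y0] := @joined_eigenvector_eq0 R (uphalf k) k./2
  (fun t => entry bbar (sx t).+1) (fun t => entry x (sx t).+1)
  (fun t => entry y (sy t).+1) lam m1 n1 _ (fun t => binary_entry bb _) _ _ _ _.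
- by lia.
- by rewrite entry_build_order_twin.
- move=> t tm; rewrite -entry_laplacian_antireg // -entryZ -xE entryD entryZ.
  rewrite entry_basis_vec ?build_order_lt // -/sx -[X in d * (_ == X)%:R]sx1.
  rewrite eqSS -dE mulrC.
  suff -> : (sx t == sx (uphalf k).-1) = (t == (uphalf k).-1) by rewrite addrK.
  by apply/eqP/eqP => [/build_order_inj|->] //; apply=> //; lia.
- move=> t tn; rewrite -entry_laplacian_antireg // -entryZ -yE.
  rewrite -scaleNr entryD entryZ mulNr.
  rewrite entry_basis_vec ?build_order_lt // -/sy -sy0 eqSS -dE (mulrC d).
  suff -> : (sy t == sy 0) = (t == 0) by rewrite subrK.
  by apply/eqP/eqP => [/build_order_inj|->] //; apply=> //; lia.
- rewrite -(sum_build_order _ m1 (fun i => entry bbar i.+1 * entry x i.+1)).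
  by rewrite -dot_entry.
by rewrite (entry_build_order_eq0 m1 x0) (entry_build_order_eq0 n1 y0) col_mx0.
Qed.

(** Twin vertices have the same neighbours apart from each other. *)
Lemma antireg_twin_eigenvector (R : realType) n (a c : 'I_n)
    (w : 'cV[R]_n := delta_mx a 0 - delta_mx c 0) :
  a.+1 = uphalf n -> c.+1 = (uphalf n).+1 ->
  laplacian R (@antireg n) *m w =
  (degree (@antireg n) a + antireg a c)%:R *: w.
Proof.
move=> aE cE; have ac : (a != c) by rewrite -val_eqE /=; lia.
have dac : degree (@antireg n) c = degree (@antireg n) a.
  by apply/eqP; rewrite eq_sym degree_antireg_eq ?aE ?cE ?eqxx //; lia.
apply/colP => l; rewrite mulmxBr -!colE !mxE natrD eqxx !andbT.
have [->|la] := eqVneq l a.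
  by rewrite (negPf ac) antireg_irr mulr1n mulr0n !subr0 sub0r opprK mulr1.
have [->|lc] := eqVneq l c.
  rewrite dac antireg_irr antireg_sym mulr1n mulr0n !subr0 !sub0r mulrN1 opprD.
  by rewrite addrC.
suff -> : antireg l a = antireg l c by rewrite !mulr0n !subr0 subrr mulr0.
rewrite /antireg la lc /=.
by move: la lc; rewrite -!val_eqE /=; lia.
Qed.

Lemma twin_vector_dot (R : realType) n (a c : 'I_n) (b : 'cV[R]_n) :
  ((delta_mx a 0 - delta_mx c 0 : 'cV[R]_n)^T *m b) 0 0 = b a 0 - b c 0.
Proof. by rewrite linearB /= !trmx_delta mulmxBl -!rowE !mxE. Qed.

Lemma antireg_controllable_entries (R : realType) n (b : 'cV[R]_n) :
  (1 < n)%N -> controllable (laplacian R (@antireg n)) b ->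
  entry b (uphalf n) != entry b (uphalf n).+1.
Proof.
move=> n1 Lb; apply/eqP => bE.
have an : ((uphalf n).-1 < n)%N by lia.
have cn : (uphalf n < n)%N by lia.
have aE : (Ordinal an).+1 = uphalf n by rewrite /=; lia.
have sym := laplacian_sym R (@antireg_sym n).
have /(controllableP _ sym) eig0 := Lb.
have := eig0 _ _ (antireg_twin_eigenvector R aE (erefl (Ordinal cn).+1)).
rewrite twin_vector_dot -!entryE aE bE subrr => /(_ erefl) /colP /(_ (Ordinal an)).
have ac : (Ordinal an == Ordinal cn) = false by rewrite -val_eqE /=; lia.
by rewrite !mxE eqxx ac subr0 => /eqP; rewrite oner_eq0.
Qed.

Lemma joined_eigenvector (R : realType) k (x : 'cV[R]_(uphalf k))
    (y : 'cV[R]_(k./2)) (lam : R) : (4 <= k)%N ->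
  laplacian R (@antireg (uphalf k)) *m x = lam *: x ->
  laplacian R (@antireg k./2) *m y = lam *: y ->
  entry x 1 = entry y (uphalf k./2) ->
  laplacian R (@joined_antireg k) *m col_mx x y = lam *: col_mx x y.
Proof.
move=> hk xE yE xy; rewrite laplacian_joined_mul // xy subrr !scale0r.
by rewrite addr0 subr0 xE yE scale_col_mx.
Qed.

(** The twin vector of the first graph vanishes at the bridge when k > 4, and is
    extended by zero. When k = 4, the bridge ends at a twin vertex in both graphs,
    and repeating the vector on the second graph makes it constant along the
    bridge. *)
Lemma joined_controllable_entries (R : realType) k (bbar : 'cV[R]_(uphalf k)) :
  (4 <= k)%N ->
  controllable (laplacian R (@joined_antireg k)) (col_mx bbar (0 : 'cV_(k./2))) ->
  entry bbar (uphalf (uphalf k)) != entry bbar (uphalf (uphalf k)).+1.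
Proof.
move=> hk; have sym := laplacian_sym R (@joined_antireg_sym k).
move=> /(controllableP _ sym) eig0; apply/eqP => bE.
have an : ((uphalf (uphalf k)).-1 < uphalf k)%N by lia.
have cn : (uphalf (uphalf k) < uphalf k)%N by lia.
set a := Ordinal an; set c := Ordinal cn.
have aE : a.+1 = uphalf (uphalf k) by rewrite /=; lia.
have twin := antireg_twin_eigenvector R aE (erefl c.+1).
set w := delta_mx a 0 - delta_mx c 0 in twin.
have w_neq0 : w a 0 != 0.
  have ac : (a == c) = false by rewrite -val_eqE /=; lia.
  by rewrite !mxE eqxx ac subr0 oner_eq0.
suff [y [yE wy]] : exists y : 'cV[R]_(k./2),
    laplacian R (@antireg k./2) *m y =
      (degree (@antireg (uphalf k)) a + antireg a c)%:R *: y /\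
    entry w 1 = entry y (uphalf k./2).
  have := eig0 _ _ (joined_eigenvector hk twin yE wy).
  rewrite tr_col_mx mul_row_col mulmx0 addr0 twin_vector_dot -!entryE aE bE.
  rewrite subrr => /(_ erefl) /eqP; rewrite col_mx_eq0 => /andP[/eqP w0 _].
  by move: w_neq0; rewrite w0 mxE eqxx.
have [k4|k5] := leqP k 4.
  have k4E : k = 4 by lia.
  by subst k; exists w.
exists 0; split; first by rewrite mulmx0 scaler0.
have m0 : (0 < uphalf k)%N by lia.
rewrite (entry_ord _ m0) !mxE -![Ordinal m0 == _]val_eqE /=.
have -> : (0 == (uphalf (uphalf k)).-1)%N = false by lia.
have -> : (0 == uphalf (uphalf k))%N = false by lia.
by rewrite /entry; case: insub => [l|]; rewrite ?mxE subrr.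
Qed.

Lemma binary_sum_eq1 (R : realType) n (v : 'cV[R]_n) i j : binary v ->
  entry v i != entry v j -> entry v i + entry v j = 1.
Proof.
move=> vb; case: (binary_entry vb i) => ->; case: (binary_entry vb j) => ->;
  by rewrite ?eqxx ?addr0 ?add0r.
Qed.

(** * Controllability of the joined graph *)

Theorem mainTheorem7 (R : realType) (k : nat) (hk : (4 <= k)%N)
  (bbar : 'cV[R]_(uphalf k)) (hb : binary bbar) :
  let b : 'cV[R]_(uphalf k + k./2) := col_mx bbar 0 in
  [<-> controllable (laplacian R (@antireg (uphalf k))) bbar;
       entry bbar (uphalf (uphalf k)) + entry bbar (uphalf (uphalf k)).+1 = 1;
       controllable (laplacian R (@joined_antireg k)) b].
Proof.
move=> b; have m1 : (1 < uphalf k)%N by lia.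
tfae.
- by move=> /(antireg_controllable_entries m1); exact: binary_sum_eq1.
- move=> b1; apply/controllableP => [|v a]; last exact: joined_antireg_eigenvector_eq0.
  exact/laplacian_sym/joined_antireg_sym.
move=> /(joined_controllable_entries hk) /(binary_sum_eq1 hb) b1.
apply/controllableP => [|v a]; last exact: antireg_eigenvector_eq0.
exact/laplacian_sym/antireg_sym.
Qed.
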